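(* The categories $\mathbf{BIS}$ and $\mathbf{LAC}$ are equivalent.
   Context: For a semigroup $S$, $a\,\mathcal{R}^*\,b$ means that for all $x,y\in S^1$, $xa=ya\Leftrightarrow xb=yb$. A semigroup $S$ is left ample if $E(S)$ is a semilattice, every $\mathcal{R}^*$-class contains a (necessarily unique) idempotent, the one in the class of $a$ being denoted $a^+$, and $xy^+=(xy^+)^+x$ for all $x,y\in S$. A $(2,1)$-morphism between left ample semigroups is a semigroup morphism preserving $^+$. A semigroup $S$ has Condition (LC) if for any $a,b\in S$ there is $c\in S$ with $Sa\cap Sb=Sc$. A $(2,1)$-morphism $\phi:S\to T$ between left ample semigroups with Condition (LC) is (LC)-preserving if for any $b,c,w\in S$ with $Sb\cap Sc=Sw$ we have $T(b\phi)\cap T(c\phi)=T(w\phi)$. $\mathbf{BIS}$ is the category whose objects are ordered pairs $(Q,S)$, where $Q$ is a bisimple inverse semigroup and $S$ is a subsemigroup of $Q$ that is a union of $\mathcal{R}^Q$-classes (Green's relation $\mathcal{R}$ on $Q$); a morphism from $(Q,S)$ to $(P,T)$ is a semigroup morphism $\psi:Q\to P$ such that $S\psi\subseteq T$. $\mathbf{LAC}$ is the category whose objects are left ample semigroups $S$ with Condition (LC) and such that $\mathcal{R}^*\circ\mathcal{L}$ is the universal relation on $S$ ($\mathcal{L}$ being Green's relation on $S$); a morphism from $S$ to $T$ is a $(2,1)$-morphism $\phi:S\to T$ that is (LC)-preserving. *)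

(* Defs.v *)
From HB Require Import structures.
From mathcomp Require Import all_boot.
From mathcomp Require Import boolp classical_sets.

Set Implicit Arguments.
Unset Strict Implicit.
Unset Printing Implicit Defensive.

Local Open Scope classical_set_scope.
Local Open Scope group_scope.

(** ** Categories *)

Record category := Category {
  obj :> Type;
  hom : obj -> obj -> Type;
  idm : forall a, hom a a;
  compm : forall a b c, hom b c -> hom a b -> hom a c;
  compmA : forall a b c d (h : hom c d) (g : hom b c) (f : hom a b),
    compm h (compm g f) = compm (compm h g) f;
  comp1m : forall a b (f : hom a b), compm (idm b) f = f;
  compm1 : forall a b (f : hom a b), compm f (idm a) = f
}.

Arguments hom {C} _ _ : rename.
Arguments idm {C} a : rename.
Arguments compm {C a b c} _ _ : rename.

Record functor (C D : category) := Functor {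
  fobj :> C -> D;
  fmap : forall a b : C, hom a b -> hom (fobj a) (fobj b);
  fmap_id : forall a : C, fmap (idm a) = idm (fobj a);
  fmap_comp : forall (a b c : C) (g : hom b c) (f : hom a b),
    fmap (compm g f) = compm (fmap g) (fmap f)
}.

Definition functor_id (C : category) : functor C C :=
  @Functor C C id (fun _ _ f => f) (fun _ => erefl) (fun _ _ _ _ _ => erefl).

Section FunctorComp.
Variables (C D E : category) (G : functor D E) (F : functor C D).

Let gf (a b : C) (f : hom a b) : hom (G (F a)) (G (F b)) := fmap G (fmap F f).

Fact functor_comp_id (a : C) : gf (idm a) = idm (G (F a)).
Proof. by rewrite /gf !fmap_id. Qed.

Fact functor_comp_comp (a b c : C) (g : hom b c) (f : hom a b) :
  gf (compm g f) = compm (gf g) (gf f).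
Proof. by rewrite /gf !fmap_comp. Qed.

Definition functor_comp : functor C E :=
  @Functor C E (fun a => G (F a)) gf functor_comp_id functor_comp_comp.

End FunctorComp.

Record nat_trans (C D : category) (F G : functor C D) := NatTrans {
  component :> forall a : C, hom (F a) (G a);
  naturality : forall (a b : C) (f : hom a b),
    compm (fmap G f) (component a) = compm (component b) (fmap F f)
}.

Definition is_iso (C : category) (a b : C) (f : hom a b) : Prop :=
  exists g : hom b a, compm g f = idm a /\ compm f g = idm b.

Definition nat_isomorphic (C D : category) (F G : functor C D) : Prop :=
  exists t : nat_trans F G, forall a : C, is_iso (t a).

Definition equivalent_categories (C D : category) : Prop :=
  exists (F : functor C D) (G : functor D C),
    nat_isomorphic (functor_id C) (functor_comp G F) /\
    nat_isomorphic (functor_comp F G) (functor_id D).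

(** ** Semigroups *)

Section Semigroups.
Variable S : semigroupType.
Implicit Types (a b c e x y : S) (A : set S).

(* An element of S^1 is an [option S], [None] being an adjoined identity.  If S
   already has an identity, [None] acts exactly as that identity does, so the
   relations below are the same as with the convention S^1 = S. *)
Definition mul1l (u : option S) a : S := if u is Some x then x * a else a.
Definition mul1r a (u : option S) : S := if u is Some x then a * x else a.

Definition greenR a b : Prop := range (mul1r a) = range (mul1r b).
Definition greenL a b : Prop := range (mul1l^~ a) = range (mul1l^~ b).
Definition greenD a b : Prop := exists c, greenR a c /\ greenL c b.

Definition Rstar a b : Prop :=
  forall u v : option S, mul1l u a = mul1l v a <-> mul1l u b = mul1l v b.

Definition idempotents : set S := [set e | e * e = e].

Definition idempotents_semilattice : Prop :=
  forall e f, idempotents e -> idempotents f ->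
    idempotents (e * f) /\ e * f = f * e.

(* The default value [a] is used only if no idempotent is R*-related to a. *)
Definition plus a : S := xget a (idempotents `&` [set e | Rstar a e]).

Definition left_ample : Prop :=
  [/\ idempotents_semilattice,
      forall a, exists2 e, idempotents e & Rstar a e
    & forall x y, x * plus y = plus (x * plus y) * x].

(* The set Sa, which involves S and not S^1. *)
Definition lmult a : set S := range (fun x => x * a).

Definition condition_LC : Prop :=
  forall a b, exists c, lmult a `&` lmult b = lmult c.

Definition subsemigroup A : Prop :=
  A !=set0 /\ forall x y, A x -> A y -> A (x * y).

Definition union_of_Rclasses A : Prop :=
  exists B : set S, A = \bigcup_(a in B) [set b | greenR a b].

Definition inverse_semigroup : Prop :=
  forall a, exists! x, a * x * a = a /\ x * a * x = x.

Definition bisimple : Prop := forall a b, greenD a b.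

Lemma idempotent_Rstar_unique a e f : idempotents_semilattice ->
  idempotents e -> idempotents f -> Rstar a e -> Rstar a f -> e = f.
Proof.
move=> com ee ff ae af.
have ea : e * a = a by apply/(ae (Some e) None).
have fa : f * a = a by apply/(af (Some f) None).
have fe : f * e = e by apply/(ae (Some f) None).
have ef : e * f = f by apply/(af (Some e) None).
by rewrite -fe -[RHS]ef; have [_ ->] := com e f ee ff.
Qed.

Lemma plusP a : left_ample -> idempotents (plus a) /\ Rstar a (plus a).
Proof.
case=> _ ex _; have [e ee ae] := ex a.
have : exists e, (idempotents `&` [set e | Rstar a e]) e by exists e.
by move=> /(xgetPex a).
Qed.

End Semigroups.

Lemma multiplicative_ext (S T : semigroupType) (f g : {multiplicative S -> T}) :
  f =1 g -> f = g.
Proof.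
case: f g => f [[fM]] [g [[gM]]] /= /funext fg.
by case: _ / fg gM => gM; rewrite (Prop_irrelevance fM gM).
Qed.

Definition preserves_plus (S T : semigroupType) (phi : S -> T) : Prop :=
  forall a, phi (plus a) = plus (phi a).

Definition LC_preserving (S T : semigroupType) (phi : S -> T) : Prop :=
  forall b c w : S, lmult b `&` lmult c = lmult w ->
    lmult (phi b) `&` lmult (phi c) = lmult (phi w).

(** ** The category BIS *)

(* Semigroups are nonempty; for Q this follows from S being nonempty. *)
Record BIS_obj := BISObj {
  BIS_Q : semigroupType;
  BIS_S : set BIS_Q;
  BIS_inverse : inverse_semigroup BIS_Q;
  BIS_bisimple : bisimple BIS_Q;
  BIS_subsemigroup : subsemigroup BIS_S;
  BIS_union : union_of_Rclasses BIS_S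
}.

Arguments BIS_S : clear implicits.

Record BIS_hom (X Y : BIS_obj) := BISHom {
  BIS_fun :> {multiplicative BIS_Q X -> BIS_Q Y};
  BIS_funS : BIS_fun @` BIS_S X `<=` BIS_S Y
}.

Lemma BIS_hom_ext (X Y : BIS_obj) (f g : BIS_hom X Y) : f =1 g -> f = g.
Proof.
case: f g => f fS [g gS] /= /multiplicative_ext fg.
by case: _ / fg gS => gS; rewrite (Prop_irrelevance fS gS).
Qed.

Section BISOps.
Variables X Y Z : BIS_obj.

Definition BIS_id : BIS_hom X X.
Proof. by exists (idfun : {multiplicative _ -> _}); move=> _ [x Sx <-]. Defined.

Definition BIS_comp (g : BIS_hom Y Z) (f : BIS_hom X Y) : BIS_hom X Z.
Proof.
exists (g \o f : {multiplicative _ -> _}) => _ [x Sx <-] /=.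
by apply: BIS_funS; exists (f x) => //; apply: BIS_funS; exists x.
Defined.

End BISOps.

Definition BIS : category.
Proof.
by apply: (@Category BIS_obj BIS_hom BIS_id BIS_comp) => *; apply: BIS_hom_ext.
Defined.

(** ** The category LAC *)

Record LAC_obj := LACObj {
  LAC_S : semigroupType;
  LAC_nonempty : inhabited LAC_S;
  LAC_left_ample : left_ample LAC_S;
  LAC_LC : condition_LC LAC_S;
  LAC_universal : forall a b : LAC_S, exists c, Rstar a c /\ greenL c b
}.

Record LAC_hom (S T : LAC_obj) := LACHom {
  LAC_fun :> {multiplicative LAC_S S -> LAC_S T};
  LAC_fun_plus : preserves_plus LAC_fun;
  LAC_fun_LC : LC_preserving LAC_fun
}.

Lemma LAC_hom_ext (S T : LAC_obj) (f g : LAC_hom S T) : f =1 g -> f = g.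
Proof.
case: f g => f fP fL [g gP gL] /= /multiplicative_ext fg.
case: _ / fg gP gL => gP gL.
by rewrite (Prop_irrelevance fP gP) (Prop_irrelevance fL gL).
Qed.

Section LACOps.
Variables S T U : LAC_obj.

Definition LAC_id : LAC_hom S S.
Proof. by exists (idfun : {multiplicative _ -> _}). Defined.

Definition LAC_comp (g : LAC_hom T U) (f : LAC_hom S T) : LAC_hom S U.
Proof.
exists (g \o f : {multiplicative _ -> _}).
- by move=> a; rewrite /= !LAC_fun_plus.
- by move=> b c w bcw; apply: LAC_fun_LC; apply: LAC_fun_LC.
Defined.

End LACOps.

Definition LAC : category.
Proof.
by apply: (@Category LAC_obj LAC_hom LAC_id LAC_comp) => *; apply: LAC_hom_ext.
Defined.

(* Main.v *)
From HB Require Import structures.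
From mathcomp Require Import all_boot.
From mathcomp Require Import boolp classical_sets.
Require Import Defs.

Set Implicit Arguments.
Unset Strict Implicit.
Unset Printing Implicit Defensive.

Local Open Scope classical_set_scope.
Local Open Scope group_scope.

(** The equivalence is the functor sending [(Q, S)] to [S] and a morphism to its
    restriction.  It is enough to see that this functor is well defined, faithful,
    full and essentially surjective; the inverse functor and the two natural
    isomorphisms then come from choice ([equivalence_of_fully_faithful]).

    Well defined.  Let [Q] be bisimple inverse and [S] a subsemigroup that is a
    union of R-classes.  For [a] in [S] the idempotent [a a^-1] is R-related to
    [a], so lies in [S]; it is [a^+], and R* on [S] is the trace of the relation R
    of [Q].  The same closure property gives that [z] in [S] lies in [Sa] as soon
    as [z a^-1 a = z], since [z a^-1] is R-related to [z].  So principal left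
    ideals of [S] are governed by the idempotents [a^-1 a], and bisimplicity
    realizes every idempotent of [Q] as [c^-1 c] with [c] in any given R-class.
    Condition (LC) and the universality of R*∘L follow, and a
    statement [Sb ∩ Sc = Sw] becomes the equation
    [w^-1 w = b^-1 b c^-1 c] ([lmult_meetP]), which morphisms of [Q] preserve.

    Faithful and full.  Every [q] in [Q] is a fraction [a^-1 b] with [a R b] in
    [S] ([carrier_fraction]).  Hence a morphism is determined on [S].
    Conversely [phi : S -> T] extends by [a^-1 b |-> (phi a)^-1 (phi b)].  Two
    fractions are equal only if their terms are obtained from each other by left
    multiplication in [S], and the product of two fractions is computed from a
    generator of an intersection [Sb ∩ Sc]; both are phrased inside [S] in terms
    that an (LC)-preserving (2,1)-morphism respects
    ([carrier_functor_full]).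

    Essentially surjective.  Given [S] in LAC, let [Q] consist of the
    isomorphisms of left [S]-acts [Sa -> Sb], [z a |-> z b], for [a R* b], under
    composition of partial maps.  Representing them by their graphs, the
    principal left ideals [S(a, b)] of [S x S], makes equality and associativity
    free of any quotient.  (LC) says that a composite is again of this form,
    universality of R*∘L says that [Q] is bisimple, and the left ample identity
    says that [a |-> (right translation by a, restricted to S a^+)] is a morphism
    of [S] into [Q], whose image is a union of R-classes ([rho_union]). *)

(** * Equivalences from fully faithful functors *)

(** The inverse functor picks a preimage [G d] of each object [d] with an
    isomorphism [eps d : F (G d) -> d], and on morphisms the [F]-preimage of the
    conjugate by [eps].  Every equation between morphisms of the source category
    is checked after applying [F], where it follows from invertibility of
    [eps]. *)
Lemma equivalence_of_fully_faithful (C D : category) (F : functor C D) :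
    (forall (a b : C) (f g : hom a b), fmap F f = fmap F g -> f = g) ->
    (forall (a b : C) (h : hom (F a) (F b)), exists f, fmap F f = h) ->
    (forall d : D, exists (c : C) (h : hom (F c) d), is_iso h) ->
  equivalent_categories C D.
Proof.
move=> faith full surj.
have ex d : {c : C & {h : hom (F c) d & {k : hom d (F c) |
    compm k h = idm _ /\ compm h k = idm _}}}.
  by have /cid[c /cid[h /cid[k hk]]] := surj d; exists c, h, k.
pose G0 d := projT1 (ex d).
pose eps d : hom (F (G0 d)) d := projT1 (projT2 (ex d)).
pose eta d : hom d (F (G0 d)) := sval (projT2 (projT2 (ex d))).
have epsK d : compm (eta d) (eps d) = idm _ /\ compm (eps d) (eta d) = idm _.
  exact: svalP (projT2 (projT2 (ex d))).
have etaeps d : compm (eta d) (eps d) = idm _ by case: (epsK d).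
have epseta d : compm (eps d) (eta d) = idm _ by case: (epsK d).
pose lift a b (h : hom (F a) (F b)) : hom a b := sval (cid (full a b h)).
have liftK a b (h : hom (F a) (F b)) : fmap F (lift a b h) = h.
  by rewrite /lift; case: cid.
pose Gmap d d' (f : hom d d') := lift _ _ (compm (eta d') (compm f (eps d))).
have Gid d : Gmap d d (idm d) = idm (G0 d).
  by apply: faith; rewrite liftK comp1m etaeps fmap_id.
have Gcomp a b c (g : hom b c) (f : hom a b) :
    Gmap a c (compm g f) = compm (Gmap b c g) (Gmap a b f).
  apply: faith; rewrite fmap_comp !liftK -!compmA.
  by congr compm; congr compm; rewrite !compmA epseta comp1m.
pose G := @Functor D C G0 Gmap Gid Gcomp.
exists F, G; split.
- pose t (a : C) : hom (functor_id C a) (functor_comp G F a) :=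
    lift _ _ (eta (F a)).
  have tN (a b : C) (f : hom a b) :
      compm (fmap (functor_comp G F) f) (t a) =
      compm (t b) (fmap (functor_id C) f).
    apply: faith; rewrite !fmap_comp /= !liftK -!compmA epseta.
    by rewrite compm1.
  exists (NatTrans tN) => a; exists (lift _ _ (eps (F a))).
  by split; apply: faith; rewrite fmap_comp !liftK fmap_id ?etaeps ?epseta.
- have tN (a b : D) (f : hom a b) :
      compm (fmap (functor_id D) f) (eps a) =
      compm (eps b) (fmap (functor_comp F G) f).
    by rewrite /= liftK compmA epseta comp1m.
  exists (NatTrans (F := functor_comp F G) (G := functor_id D) tN) => d.
  by exists (eta d); apply: epsK.
Qed.

(** * The relations R*, R and L *)

Section Multiplicative.
Variables (S T : semigroupType) (f : S -> T).
Hypothesis fM : {morph f : x y / x * y}.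
HB.instance Definition _ := isMultiplicative.Build S T f fM.
Definition multiplicative_of : {multiplicative S -> T} := f.
End Multiplicative.

Section Rstar.
Variable S : semigroupType.
Implicit Types a b c e x y z : S.

Lemma mul1lM (u : option S) x y : mul1l u (x * y) = mul1l u x * y.
Proof. by case: u => //= z; rewrite mulgA. Qed.

Lemma Rstar_sym a b : Rstar a b -> Rstar b a.
Proof. by move=> ab u v; rewrite ab. Qed.

Lemma Rstar_trans b a c : Rstar a b -> Rstar b c -> Rstar a c.
Proof. by move=> ab bc u v; rewrite ab bc. Qed.

Lemma Rstar_mul1l (x : option S) a b :
  Rstar a b -> Rstar (mul1l x a) (mul1l x b).
Proof.
case: x => //= x ab u v.
pose ux w : option S := Some (mul1l w x).
have E w c : mul1l w (x * c) = mul1l (ux w) c by rewrite mul1lM.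
by rewrite !E; apply: ab.
Qed.

Lemma Rstar_mull x a b : Rstar a b -> Rstar (x * a) (x * b).
Proof. exact: (Rstar_mul1l (Some x)). Qed.

Lemma Rstar_eq x y a b : Rstar a b -> x * a = y * a -> x * b = y * b.
Proof. by move=> ab; exact: (proj1 (ab (Some x) (Some y))). Qed.

Lemma Rstar_fix x a b : Rstar a b -> x * a = a -> x * b = b.
Proof. by move=> ab; exact: (proj1 (ab (Some x) None)). Qed.

Lemma plus_unique a e : idempotents_semilattice S ->
  idempotents e -> Rstar a e -> plus a = e.
Proof.
move=> com ee ae.
have : exists e, (@idempotents S `&` [set e | Rstar a e]) e by exists e.
move=> /(xgetPex a) [pp ap]; exact: (idempotent_Rstar_unique com pp ee ap ae).
Qed.

(** In this form the relation is transported by anything multiplicative, and it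
    can be proved by exhibiting two multipliers. *)
Lemma greenLP a b :
  greenL a b <-> exists u v : option S, a = mul1l u b /\ b = mul1l v a.
Proof.
split=> [ab|[u [v [au bv]]]].
  have [u _ ub] : range ((@mul1l S)^~ b) a by rewrite -ab; exists None.
  have [v _ va] : range ((@mul1l S)^~ a) b by rewrite ab; exists None.
  by exists u, v.
apply/seteqP; split=> _ [w _ <-].
- case: w => [w|] /=; last by exists u.
  by case: u au => [u|] /= ->; [exists (Some (w * u)) | exists (Some w)];
    rewrite //= mulgA.
- case: w => [w|] /=; last by exists v.
  by case: v bv => [v|] /= ->; [exists (Some (w * v)) | exists (Some w)];
    rewrite //= mulgA.
Qed.

Lemma greenRP a b :
  greenR a b <-> exists u v : option S, a = mul1r b u /\ b = mul1r a v.
Proof.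
split=> [ab|[u [v [au bv]]]].
  have [u _ ub] : range (mul1r b) a by rewrite -ab; exists None.
  have [v _ va] : range (mul1r a) b by rewrite ab; exists None.
  by exists u, v.
apply/seteqP; split=> _ [w _ <-].
- case: w => [w|] /=; last by exists u.
  by case: u au => [u|] /= ->; [exists (Some (u * w)) | exists (Some w)];
    rewrite //= mulgA.
- case: w => [w|] /=; last by exists v.
  by case: v bv => [v|] /= ->; [exists (Some (v * w)) | exists (Some w)];
    rewrite //= mulgA.
Qed.

End Rstar.

(** * Inverse semigroups *)

(** A total operation, so that it can be written without carrying the proof that
    the semigroup is inverse; outside inverse semigroups its value is arbitrary. *)
Definition ginv (Q : semigroupType) (a : Q) : Q :=
  xget a [set x | a * x * a = a /\ x * a * x = x].

Local Notation "x ^-1" := (ginv x) : group_scope.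

Section InverseSemigroup.
Variable Q : semigroupType.
Hypothesis invQ : inverse_semigroup Q.
Implicit Types a b c d e f m u v x y : Q.

Lemma ginvP a : a * a^-1 * a = a /\ a^-1 * a * a^-1 = a^-1.
Proof.
have [x [ax _]] := invQ a.
have ex : exists x, [set x | a * x * a = a /\ x * a * x = x] x by exists x.
exact: (xgetPex a ex).
Qed.

Lemma mulgVg a : a * a^-1 * a = a. Proof. by case: (ginvP a). Qed.

Lemma mulVgV a : a^-1 * a * a^-1 = a^-1. Proof. by case: (ginvP a). Qed.

Lemma mulgVgA x a : x * a * a^-1 * a = x * a.
Proof. by rewrite -!mulgA (mulgA a) mulgVg. Qed.

Lemma mulVgVA x a : x * a^-1 * a * a^-1 = x * a^-1.
Proof. by rewrite -!mulgA (mulgA a^-1) mulVgV. Qed.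

Lemma ginv_unique a x : a * x * a = a -> x * a * x = x -> a^-1 = x.
Proof.
move=> h1 h2; have [y [_ uy]] := invQ a.
by rewrite -(uy _ (ginvP a)) (uy x).
Qed.

Lemma ginvK a : a^-1^-1 = a.
Proof. by apply: ginv_unique; rewrite ?mulgVg ?mulVgV. Qed.

Lemma ginv_idem e : idempotents e -> e^-1 = e.
Proof. by rewrite /idempotents /= => ee; apply: ginv_unique; rewrite !ee. Qed.

Lemma idempotents_gV a : idempotents (a * a^-1).
Proof. by rewrite /idempotents /= mulgA mulgVg. Qed.

Lemma idempotents_Vg a : idempotents (a^-1 * a).
Proof. by rewrite /idempotents /= mulgA mulVgV. Qed.

(** With [x] the inverse of [e f], the element [f x e] is another inverse of
    [e f].  So [x = f x e], which is visibly idempotent; and then [e f], being the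
    inverse of an idempotent, is idempotent too. *)
Lemma idempotentsM e f : idempotents e -> idempotents f -> idempotents (e * f).
Proof.
rewrite /idempotents /= => ee ff; set x := (e * f)^-1.
have eA y : y * e * e = y * e by rewrite -mulgA ee.
have fA y : y * f * f = y * f by rewrite -mulgA ff.
have xA : e * f * x * e * f = e * f by rewrite -(mulgA _ e) mulgVg.
have xAx y : y * x * e * f * x = y * x.
  by rewrite -!mulgA (mulgA e) (mulgA x) mulVgV.
have fxe : x = f * x * e.
  by apply: ginv_unique; rewrite !mulgA ?eA ?fA ?xA ?xAx.
have xx : idempotents x.
  by rewrite /idempotents /= {1}fxe {2}fxe !mulgA xAx -fxe.
by rewrite -(ginvK (e * f)) (ginv_idem xx).
Qed.

(** Both [e f] and [f e] are idempotent by the previous lemma, which makes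
    [f e] an inverse of [e f]; but the idempotent [e f] is its own inverse. *)
Lemma idempotentsC e f : idempotents e -> idempotents f -> e * f = f * e.
Proof.
move=> he hf; have hef := idempotentsM he hf; have hfe := idempotentsM hf he.
rewrite -(ginv_idem hef).
move: he hf hef hfe; rewrite /idempotents /= => ee ff hef hfe.
by apply: ginv_unique; rewrite !mulgA -!(mulgA _ f f) -!(mulgA _ e e) ?ee ?ff
   -?[RHS]hef -?[RHS]hfe !mulgA.
Qed.

Lemma ginvM a b : (a * b)^-1 = b^-1 * a^-1.
Proof.
have C y : y * b * b^-1 * a^-1 * a = y * a^-1 * a * b * b^-1.
  rewrite -!mulgA; congr (y * _); rewrite !mulgA -(mulgA _ a^-1) -[RHS]mulgA.
  exact: idempotentsC (idempotents_gV b) (idempotents_Vg a).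
apply: ginv_unique; rewrite !mulgA.
- by rewrite C mulgVg mulgVgA.
- by rewrite -C mulVgV mulVgVA.
Qed.

(** This is the left ample identity: [x e x^-1] is [(x e)^+]. *)
Lemma mul_idem_swap x e : idempotents e -> x * e = x * e * x^-1 * x.
Proof.
move=> ee; rewrite -!mulgA -(idempotentsC (idempotents_Vg x) ee).
by rewrite !mulgA mulgVg.
Qed.

Lemma greenR_gV a b : greenR a b <-> a * a^-1 = b * b^-1.
Proof.
rewrite greenRP; split=> [[u [v [au bv]]]|ab].
  have ba : b * b^-1 * a = a.
    by rewrite au; case: u {au} => [u|] /=; rewrite ?mulgA mulgVg.
  have ab : a * a^-1 * b = b.
    by rewrite bv; case: v {bv} => [v|] /=; rewrite ?mulgA mulgVg.
  have := idempotentsC (idempotents_gV b) (idempotents_gV a).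
  by rewrite !mulgA ba ab.
exists (Some (b^-1 * a)), (Some (a^-1 * b)) => /=.
by rewrite !mulgA ab mulgVg -ab mulgVg.
Qed.

Lemma greenL_Vg a b : greenL a b <-> a^-1 * a = b^-1 * b.
Proof.
rewrite greenLP; split=> [[u [v [au bv]]]|ab].
  have ba : a * b^-1 * b = a.
    by rewrite au; case: u {au} => [u|] /=; rewrite -?mulgA ?(mulgA b) mulgVg.
  have ab : b * a^-1 * a = b.
    by rewrite bv; case: v {bv} => [v|] /=; rewrite -?mulgA ?(mulgA a) mulgVg.
  have := idempotentsC (idempotents_Vg a) (idempotents_Vg b).
  rewrite !mulgA -(mulgA a^-1) -(mulgA a^-1) -(mulgA b^-1) -(mulgA b^-1).
  by rewrite ba ab.
exists (Some (a * b^-1)), (Some (b * a^-1)) => /=.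
by split; rewrite -mulgA; [rewrite -ab | rewrite ab]; rewrite mulgA mulgVg.
Qed.

(** A fraction does not change when numerator and denominator are multiplied on
    the left by [s], provided that this loses nothing on the denominator: [t]
    undoes it.  Indeed [t s a = a] puts [a a^-1] below [s^-1 s]. *)
Lemma fraction_eq s t a b c d :
  c = s * a -> d = s * b -> a = t * c -> c^-1 * d = a^-1 * b.
Proof.
move=> -> -> ats; rewrite mulgA in ats.
set f := a * a^-1; set e := s^-1 * s.
have tsf : t * s * f = f by rewrite /f mulgA -ats.
have fe : f * e = f.
  rewrite -[in LHS]tsf -mulgA.
  rewrite (idempotentsC (idempotents_gV a) (idempotents_Vg s)).
  by rewrite !mulgA mulgVgA -ats.
rewrite ginvM !mulgA -(mulVgV a) -(mulgA _ a) -/f.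
by rewrite -(mulgA _ s^-1) -/e -(mulgA _ f e) fe.
Qed.

(** Bringing fractions to a common middle term: [b c^-1] only depends on its
    restriction to the idempotent [b^-1 b c^-1 c = m^-1 m], and there
    [m = u b = v c] turns it into [u^-1 v]. *)
Lemma fraction_mul a b c d u v m :
    a * a^-1 = b * b^-1 -> c * c^-1 = d * d^-1 ->
    m = u * b -> m = v * c -> m^-1 * m = b^-1 * b * (c^-1 * c) ->
  (a^-1 * b) * (c^-1 * d) = (u * a)^-1 * (v * d).
Proof.
move=> ab cd mu mv mm.
have -> : a^-1 * b * (c^-1 * d) =
    a^-1 * b * (b^-1 * b * (c^-1 * c)) * (c^-1 * d).
  by rewrite !mulgA !mulgVgA !mulVgVA.
rewrite -mm {1}mu mv !ginvM !mulgA.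
by rewrite -(mulgA a^-1 b) -ab mulgA mulVgV -(mulgA _ c c^-1) cd -mulgA mulgVg.
Qed.

End InverseSemigroup.

Lemma multiplicative_ginv (P Q : semigroupType) (f : {multiplicative P -> Q}) :
  inverse_semigroup P -> inverse_semigroup Q -> forall a, f a^-1 = (f a)^-1.
Proof.
move=> iP iQ a; symmetry; apply: (ginv_unique iQ); rewrite -!gmulfM.
  by rewrite mulgVg.
by rewrite mulVgV.
Qed.

(** * From pairs (Q, S) to left ample semigroups *)

Section Carrier.
Variable X : BIS_obj.
Let Q := BIS_Q X.
Let invQ : inverse_semigroup Q := @BIS_inverse X.
Implicit Types q r : Q.

Lemma BIS_mem_gV q r : BIS_S X q -> q * q^-1 = r * r^-1 -> BIS_S X r.
Proof.
have [B ->] := BIS_union X => -[b Bb /= bq] /(greenR_gV invQ) qr.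
by exists b => //=; rewrite /greenR bq qr.
Qed.

Lemma BIS_memM q r : BIS_S X q -> BIS_S X r -> BIS_S X (q * r).
Proof. by case: (BIS_subsemigroup X) => _; apply. Qed.

(** An egg-box of a bisimple semigroup has no empty cell: the R-class of [q]
    meets the L-class of [r]. *)
Lemma BIS_cross q r : exists2 c : Q,
  c * c^-1 = q * q^-1 & c^-1 * c = r^-1 * r.
Proof.
have [c [/(greenR_gV invQ) qc /(greenL_Vg invQ) cr]] := BIS_bisimple q r.
by exists c.
Qed.

Definition carrier : Type := {q : Q | q \in BIS_S X}.
HB.instance Definition _ := Choice.on carrier.
Implicit Types a b c w z : carrier.

Lemma carrierP a : BIS_S X (val a).
Proof. by have := valP a; rewrite inE. Qed.

Definition carrier_of q (Sq : BIS_S X q) : carrier := exist _ q (mem_set Sq).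

Lemma carrier_lift q : BIS_S X q -> exists a, val a = q.
Proof. by move=> Sq; exists (carrier_of Sq). Qed.

Definition carrier_mul a b : carrier :=
  carrier_of (BIS_memM (carrierP a) (carrierP b)).

Fact carrier_mulA : associative carrier_mul.
Proof. by move=> a b c; apply: val_inj; rewrite /= mulgA. Qed.

HB.instance Definition _ := isSemigroup.Build carrier carrier_mulA.

Lemma val_mul a b : val (a * b) = val a * val b.
Proof. by []. Qed.

Lemma val_mul1l (u : option carrier) a :
  val (mul1l u a) = mul1l (omap val u) (val a).
Proof. by case: u. Qed.

Lemma carrier_gV a : exists e : carrier, val e = val a * (val a)^-1.
Proof.
apply: carrier_lift; apply: BIS_mem_gV (carrierP a) _.
have ee := idempotents_gV invQ (val a).
by rewrite (ginv_idem invQ ee) ee.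
Qed.

(** As [S^1] embeds in [Q^1], this gives [a R* a a^-1] in [S] as well. *)
Lemma mul1l_gV (u v : option Q) q :
  mul1l u q = mul1l v q <-> mul1l u (q * q^-1) = mul1l v (q * q^-1).
Proof.
split=> h; first by rewrite !mul1lM h.
by rewrite -(mulgVg invQ q) !(mul1lM _ (q * q^-1)) h.
Qed.

Lemma carrier_Rstar a b :
  Rstar a b <-> val a * (val a)^-1 = val b * (val b)^-1.
Proof.
split=> [ab|ab u v].
  have [e ea] := carrier_gV a; have [f fb] := carrier_gV b.
  have eb : e * b = b.
    by apply: (Rstar_fix ab); apply: val_inj; rewrite val_mul ea mulgVg.
  have fa : f * a = a.
    apply: (Rstar_fix (Rstar_sym ab)).
    by apply: val_inj; rewrite val_mul fb mulgVg.
  have -> : val a * (val a)^-1 = val f * val e by rewrite ea mulgA -val_mul fa.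
  have -> : val b * (val b)^-1 = val e * val f by rewrite fb mulgA -val_mul eb.
  by rewrite ea fb (idempotentsC invQ (idempotents_gV invQ _)
    (idempotents_gV invQ _)).
have E c : mul1l u c = mul1l v c <->
    mul1l (omap val u) (val c) = mul1l (omap val v) (val c).
  by rewrite -!val_mul1l; split=> [->//|/val_inj].
by rewrite !E !(mul1l_gV _ _ (val _)) ab.
Qed.

Lemma carrier_semilattice : idempotents_semilattice carrier.
Proof.
have E (e : carrier) : idempotents e <-> idempotents (val e).
  by split=> [/(congr1 val)|h] //; apply: val_inj.
move=> e f /E ee /E ff; rewrite E; split; first exact: idempotentsM.
by apply: val_inj; apply: (idempotentsC invQ).
Qed.

Lemma val_plus a : val (plus a) = val a * (val a)^-1.
Proof.
have [e ea] := carrier_gV a.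
have ee := idempotents_gV invQ (val a).
rewrite (plus_unique (e := e) carrier_semilattice) //.
  by apply: val_inj; rewrite val_mul ea.
by rewrite carrier_Rstar ea (ginv_idem invQ ee) ee.
Qed.

Lemma carrier_left_ample : left_ample carrier.
Proof.
split; first exact: carrier_semilattice.
  move=> a; have [e ea] := carrier_gV a.
  have ee := idempotents_gV invQ (val a).
  exists e; first by apply: val_inj; rewrite val_mul ea.
  by rewrite carrier_Rstar ea (ginv_idem invQ ee) ee.
move=> x y; apply: val_inj; rewrite !(val_mul, val_plus).
have ee := idempotents_gV invQ (val y); move: (_ * _^-1) ee => e ee.
rewrite (ginvM invQ) (ginv_idem invQ ee) mulgA -(mulgA _ e e) ee.
exact: mul_idem_swap.
Qed.

(** The multiplier witnessing [z \in S a] is [z a^-1], which is in [S] because it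
    is R-related to [z]. *)
Lemma carrier_lmult a z : lmult a z <-> val z * (val a)^-1 * val a = val z.
Proof.
split=> [[x _ <-]|za].
  by rewrite val_mul (mulgVgA invQ).
have zR : val z * (val z)^-1 =
    val z * (val a)^-1 * (val z * (val a)^-1)^-1.
  by rewrite (ginvM invQ) (ginvK invQ) !mulgA za.
exists (carrier_of (BIS_mem_gV (carrierP z) zR)) => //.
exact: val_inj.
Qed.

Lemma carrier_crossL a q : exists c, [/\ val c * (val c)^-1 = val a * (val a)^-1
  & (val c)^-1 * val c = q^-1 * q].
Proof.
have [c ca cq] := BIS_cross (val a) q.
by have [c' c'E] := carrier_lift (BIS_mem_gV (carrierP a) (esym ca));
  exists c'; rewrite c'E.
Qed.

Lemma lmult_meet a b c :
    (val c)^-1 * val c = (val a)^-1 * val a * ((val b)^-1 * val b) ->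
  lmult a `&` lmult b = lmult c.
Proof.
move=> cab; apply/seteqP; split=> z.
  move=> [/carrier_lmult za /carrier_lmult zb].
  by apply/carrier_lmult; rewrite -mulgA cab !mulgA za zb.
move=> /carrier_lmult; rewrite -mulgA cab => zc.
split; apply/carrier_lmult; rewrite -zc.
  rewrite (idempotentsC invQ (idempotents_Vg invQ _) (idempotents_Vg invQ _)).
  by rewrite !mulgA (mulgVgA invQ).
by rewrite !mulgA (mulgVgA invQ).
Qed.

(** Intersections of principal left ideals of [S] are equations between
    idempotents of [Q].  For the direct implication, an element [c] of [S] with
    [c^-1 c = a^-1 a b^-1 b] exists by bisimplicity; then [S c = S w], so that [c]
    and [w] are L-related. *)
Lemma lmult_meetP a b w : lmult a `&` lmult b = lmult w <->
  (val w)^-1 * val w = (val a)^-1 * val a * ((val b)^-1 * val b).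
Proof.
split; last exact: lmult_meet.
have ff := idempotentsM invQ (idempotents_Vg invQ (val a))
  (idempotents_Vg invQ (val b)).
have meet c := @lmult_meet a b c.
set f := (val a)^-1 * val a * _ in ff meet *; move=> abw.
have [c [_]] := carrier_crossL a f; rewrite (ginv_idem invQ ff) ff => cf.
have cw : lmult c = lmult w by rewrite -abw (meet c).
have self z : lmult z z by rewrite carrier_lmult (mulgVg invQ).
have /carrier_lmult wc : lmult c w by rewrite cw; apply: self.
have /carrier_lmult cw' : lmult w c by rewrite -cw; apply: self.
by rewrite -cf; apply/(greenL_Vg invQ)/greenLP;
  exists (Some (val w * (val c)^-1)), (Some (val c * (val w)^-1)).
Qed.

Lemma carrier_LC : condition_LC carrier.
Proof.
move=> a b; have ff := idempotentsM invQ (idempotents_Vg invQ (val a))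
  (idempotents_Vg invQ (val b)).
have [c [_ cf]] := carrier_crossL a ((val a)^-1 * val a * ((val b)^-1 * val b)).
by exists c; apply: lmult_meet; rewrite cf (ginv_idem invQ ff) ff.
Qed.

Lemma carrier_universal a b : exists c, Rstar a c /\ greenL c b.
Proof.
have [c [ca cb]] := carrier_crossL a (val b).
exists c; split; first by rewrite carrier_Rstar ca.
have /carrier_lmult[x _ xb] : val c * (val b)^-1 * val b = val c.
  by rewrite -mulgA -cb mulgA mulgVg.
have /carrier_lmult[y _ yc] : val b * (val c)^-1 * val c = val b.
  by rewrite -mulgA cb mulgA mulgVg.
by apply/greenLP; exists (Some x), (Some y).
Qed.

Lemma carrier_inhabited : inhabited carrier.
Proof.
by have [[q Sq] _] := BIS_subsemigroup X; exists; exact: carrier_of Sq.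
Qed.

Definition carrier_LAC : LAC_obj :=
  LACObj carrier_inhabited carrier_left_ample carrier_LC carrier_universal.

(** Choose [c] in [S] with [c^-1 c = q q^-1]; then [q = c^-1 (c q)], and [c q] is
    R-related to [c], so lies in [S]. *)
Lemma carrier_fraction q : exists a b,
  Rstar a b /\ q = (val a)^-1 * val b.
Proof.
have [a0] := carrier_inhabited.
have [c [ca cq]] := carrier_crossL a0 q^-1.
rewrite (ginvK invQ) in cq.
have cqR : val c * (val c)^-1 = val c * q * (val c * q)^-1.
  by rewrite (ginvM invQ) !mulgA -(mulgA _ q) -cq mulgA !(mulgVg invQ).
have [b bE] := carrier_lift (BIS_mem_gV (carrierP c) cqR).
by exists c, b; rewrite carrier_Rstar bE mulgA cq (mulgVg invQ).
Qed.

(** Equality of fractions is witnessed inside [S].  The left side determines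
    [a^-1 a], so [a] and [c] generate the same left ideal of [S]; the multiplier
    that sends [a] to [c] also sends [b] to [d].  This is what makes the extension
    of a morphism from [S] to [Q] well defined. *)
Lemma carrier_fraction_mulP a b c d : Rstar a b -> Rstar c d ->
    (val a)^-1 * val b = (val c)^-1 * val d ->
  exists s t, [/\ c = s * a, d = s * b & a = t * c].
Proof.
move=> /carrier_Rstar ab /carrier_Rstar cd abcd.
have sq q r : q * q^-1 = r * r^-1 -> (q^-1 * r) * (q^-1 * r)^-1 = q^-1 * q.
  move=> qr; rewrite (ginvM invQ) (ginvK invQ) mulgA -(mulgA _ r) -qr mulgA.
  by rewrite (mulVgV invQ).
have ac : (val a)^-1 * val a = (val c)^-1 * val c.
  by rewrite -(sq _ _ ab) -(sq _ _ cd) abcd.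
have /carrier_lmult[s _ sa] : val c * (val a)^-1 * val a = val c.
  by rewrite -mulgA ac mulgA mulgVg.
have /carrier_lmult[t _ tc] : val a * (val c)^-1 * val c = val a.
  by rewrite -mulgA -ac mulgA mulgVg.
exists s, t; split=> //; apply: val_inj; rewrite val_mul.
have -> : val b = val a * ((val a)^-1 * val b).
  by rewrite mulgA ab (mulgVg invQ).
by rewrite abcd mulgA -val_mul sa mulgA cd (mulgVg invQ).
Qed.

End Carrier.

(** R*-related elements are those with the same [^+]. *)
Lemma carrier_hom_Rstar (X Y : BIS_obj)
    (phi : LAC_hom (carrier_LAC X) (carrier_LAC Y)) (a b : carrier X) :
  Rstar a b -> Rstar (phi a : carrier Y) (phi b).
Proof.
have invX := @BIS_inverse X.
rewrite carrier_Rstar -!val_plus => /val_inj ab.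
have phiE (c : carrier X) : plus (phi c : carrier Y) = phi (plus c).
  exact: esym (LAC_fun_plus phi c).
by rewrite carrier_Rstar -!val_plus !phiE ab.
Qed.

(** * The restriction functor *)

Section CarrierMap.
Variables (X Y : BIS_obj) (h : BIS_hom X Y).

Definition carrier_map (a : carrier X) : carrier Y :=
  carrier_of (BIS_funS (b := h) (ex_intro2 _ _ (val a) (carrierP a) erefl)).

Lemma val_carrier_map a : val (carrier_map a) = h (val a).
Proof. by []. Qed.

Fact carrier_mapM : {morph carrier_map : a b / a * b}.
Proof. by move=> a b; apply: val_inj; rewrite /= gmulfM. Qed.

Let hV := multiplicative_ginv h (@BIS_inverse X) (@BIS_inverse Y).

Fact carrier_map_plus : preserves_plus carrier_map.
Proof.
by move=> a; apply: val_inj; rewrite /= !val_plus gmulfM hV.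
Qed.

Fact carrier_map_LC : LC_preserving carrier_map.
Proof.
move=> b c w /lmult_meetP bcw; apply/lmult_meetP.
by rewrite !val_carrier_map -!hV -!gmulfM bcw.
Qed.

Definition carrier_hom : LAC_hom (carrier_LAC X) (carrier_LAC Y) :=
  @LACHom (carrier_LAC X) (carrier_LAC Y) (multiplicative_of carrier_mapM)
    carrier_map_plus carrier_map_LC.

End CarrierMap.

Fact carrier_hom_id (X : BIS_obj) :
  carrier_hom (@idm BIS X) = idm (carrier_LAC X : LAC).
Proof. by apply: LAC_hom_ext => a; apply: val_inj. Qed.

Fact carrier_hom_comp (X Y Z : BIS_obj) (g : BIS_hom Y Z) (f : BIS_hom X Y) :
  carrier_hom (@compm BIS X Y Z g f) =
  @compm LAC _ _ _ (carrier_hom g) (carrier_hom f).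
Proof. by apply: LAC_hom_ext => a; apply: val_inj. Qed.

Definition carrier_functor : functor BIS LAC :=
  @Functor BIS LAC carrier_LAC carrier_hom carrier_hom_id carrier_hom_comp.

(** A morphism preserves inverses, hence its values on fractions are determined
    by those on [S]. *)
Lemma carrier_functor_faithful (X Y : BIS_obj) (f g : BIS_hom X Y) :
  carrier_hom f = carrier_hom g -> f = g.
Proof.
move=> fg; apply: BIS_hom_ext => q.
have E (a : carrier X) : f (val a) = g (val a).
  pose ev (k : LAC_hom (carrier_LAC X) (carrier_LAC Y)) :=
    val (k a : carrier Y).
  by have := congr1 ev fg; rewrite /ev /=.
have [a [b [_ ->]]] := carrier_fraction q.
rewrite !gmulfM !(multiplicative_ginv _ (@BIS_inverse X) (@BIS_inverse Y)).
by rewrite !E.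
Qed.

(** The extension of [phi] sends [a^-1 b] to [(phi a)^-1 (phi b)].  It is
    multiplicative because [fraction_mul] computes products in [Q] and in the
    target from the same data: a generator [m = u b = v c] of [Sb ∩ Sc], whose
    image generates the corresponding intersection as [phi] is
    (LC)-preserving. *)
Lemma carrier_functor_full (X Y : BIS_obj)
    (phi : LAC_hom (carrier_LAC X) (carrier_LAC Y)) :
  exists f : BIS_hom X Y, carrier_hom f = phi.
Proof.
have invX := @BIS_inverse X; have invY := @BIS_inverse Y.
pose p (a : carrier X) : carrier Y := phi a.
have pM a b : val (p (a * b)) = val (p a) * val (p b) by rewrite /p gmulfM.
have pR a b : Rstar a b -> Rstar (p a) (p b) by exact: carrier_hom_Rstar.
have ex q : {ab : carrier X * carrier X |
    Rstar ab.1 ab.2 /\ q = (val ab.1)^-1 * val ab.2}.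
  by apply: cid; have [a [b ab]] := carrier_fraction q; exists (a, b).
pose psi q := (val (p (sval (ex q)).1))^-1 * val (p (sval (ex q)).2).
have psiE (a b : carrier X) : Rstar a b ->
    psi ((val a)^-1 * val b) = (val (p a))^-1 * val (p b).
  move=> ab; rewrite /psi; case: (ex _) => -[c d] /= [cd abcd].
  have [s [t [-> -> aE]]] := carrier_fraction_mulP ab cd abcd.
  apply: (fraction_eq (s := val (p s)) (t := val (p t)) invY); rewrite ?pM //.
  by rewrite {1}aE !pM.
have psiM : {morph psi : q r / q * r}.
  move=> q r.
  have [a [b [ab ->]]] := carrier_fraction q.
  have [c [d [cd ->]]] := carrier_fraction r.
  rewrite (psiE _ _ ab) (psiE _ _ cd).
  have [m bcm] := carrier_LC b c.
  have self : lmult m m by rewrite carrier_lmult (mulgVg invX).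
  have [[u _ um] [v _ vm]] : (lmult b `&` lmult c) m by rewrite bcm.
  have pbcm : lmult (p b) `&` lmult (p c) = lmult (p m).
    exact: (@LAC_fun_LC _ _ phi b c m bcm).
  have := pR _ _ cd; have := pR _ _ ab.
  rewrite !carrier_Rstar => pab pcd.
  rewrite (fraction_mul (u := val (p u)) (v := val (p v)) (m := val (p m))
    invY pab pcd) -?pM ?um ?vm //; last exact/lmult_meetP.
  move: (ab) (cd); rewrite !carrier_Rstar => ab' cd'.
  rewrite (fraction_mul (u := val u) (v := val v) (m := val m) invX ab' cd')
    -?val_mul ?um ?vm //; last exact/lmult_meetP.
  apply: psiE; apply: (Rstar_trans (b := m)).
    by rewrite -um; apply: Rstar_mull.
  by rewrite -vm; apply: Rstar_mull.
(* An element [a] of [S] is the fraction with denominator [a^+]. *)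
have psi_val (a : carrier X) : psi (val a) = val (p a).
  have [e ea] := carrier_gV a.
  have ee := idempotents_gV invX (val a).
  have eR : Rstar e a by rewrite carrier_Rstar ea (ginv_idem invX ee) ee.
  have aE : val a = (val e)^-1 * val a.
    by rewrite ea (ginv_idem invX ee) (mulgVg invX).
  have eP : e = plus a by apply: val_inj; rewrite val_plus.
  have peP : val (p e) = val (p a) * (val (p a))^-1.
    by rewrite -val_plus eP; congr (val _); exact: (LAC_fun_plus phi a).
  rewrite {1}aE psiE // peP (ginv_idem invY (idempotents_gV invY _)).
  exact: mulgVg.
have psiS : multiplicative_of psiM @` BIS_S X `<=` BIS_S Y.
  move=> _ [q Sq <-]; have [a <-] := carrier_lift Sq.
  by rewrite /= psi_val; apply: carrierP.
exists (BISHom psiS); apply: LAC_hom_ext => a; apply: val_inj.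
exact: psi_val.
Qed.

(** * From left ample semigroups to pairs (Q, S) *)

(** The operation [^+] and the left ideals are determined by the multiplication,
    so every semigroup isomorphism is an isomorphism of LAC. *)
Lemma LAC_iso_of_bijective (S T : LAC_obj) (g : LAC_S S -> LAC_S T) :
    {morph g : a b / a * b} -> injective g -> (forall b, exists a, g a = b) ->
  exists h : LAC_hom T S, is_iso (C := LAC) h.
Proof.
move=> gM ginj gsurj; have [h hK] := choice gsurj.
have gK : cancel g h by move=> a; apply: ginj; rewrite hK.
have hM : {morph h : a b / a * b}.
  by move=> a b; apply: ginj; rewrite gM !hK.
have hom_of (U V : LAC_obj) (f : LAC_S U -> LAC_S V) (k : LAC_S V -> LAC_S U)
    (fM : {morph f : a b / a * b}) (kM : {morph k : a b / a * b}) :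
    cancel f k -> cancel k f -> {F : LAC_hom U V | LAC_fun F =1 f}.
  move=> fK kK.
  have fR a b : Rstar a b -> Rstar (f a) (f b).
    move=> ab u v.
    have E w c : k (mul1l w (f c)) = mul1l (omap k w) c.
      by case: w => [w|] /=; rewrite ?kM fK.
    have E' w c d : mul1l w (f c) = mul1l d (f c) <->
        mul1l (omap k w) c = mul1l (omap k d) c.
      by rewrite -!E; split=> [->//|/(can_inj kK)].
    by rewrite !E'.
  have fP : preserves_plus f.
    move=> a; have [ee aR] := plusP a (LAC_left_ample U).
    have [com _ _] := LAC_left_ample V.
    symmetry; apply: plus_unique com _ (fR _ _ aR).
    by rewrite /idempotents /= -fM ee.
  have fL : LC_preserving f.
    have E a : lmult (f a) = k @^-1` lmult a.
      apply/seteqP; split=> [_ [x _ <-]|z [x _ xa]].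
        by exists (k x); rewrite ?kM ?fK.
      by exists (f x); rewrite // -fM xa kK.
    by move=> b c w bcw; rewrite !E -bcw.
  by exists (@LACHom U V (multiplicative_of fM) fP fL).
have [G GE] := hom_of _ _ g h gM hM gK hK.
have [H HE] := hom_of _ _ h g hM gM hK gK.
exists H, G; split; apply: LAC_hom_ext => a /=.
  by rewrite GE HE hK.
by rewrite HE GE gK.
Qed.

Section Fractions.
Variable S : LAC_obj.
Implicit Types a b c d e m u v x y z : LAC_S S.

(** For [a R* b] this is the graph of the isomorphism of left [S]-acts
    [S a -> S b] sending [a] to [b]. *)
Definition graph a b : set (LAC_S S * LAC_S S) :=
  [set p | exists z, p = (z * a, z * b)].

Definition is_fraction (A : set (LAC_S S * LAC_S S)) : Prop :=
  exists a b, Rstar a b /\ A = graph a b.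

Definition fraction : Type := {A | is_fraction A}.

HB.instance Definition _ := gen_eqMixin fraction.
HB.instance Definition _ := gen_choiceMixin fraction.

Implicit Types p q r : fraction.

Definition frac a b (ab : Rstar a b) : fraction :=
  exist _ _ (ex_intro _ a (ex_intro _ b (conj ab erefl))).

Lemma fraction_inj p q : sval p = sval q -> p = q.
Proof.
case: p q => A fA [B fB] /= AB; case: _ / AB fB => fB.
by rewrite (Prop_irrelevance fA fB).
Qed.

Lemma fracP q : exists a b (ab : Rstar a b), q = frac ab.
Proof.
case: q => A [a [b [ab AE]]]; exists a, b, ab.
by apply: fraction_inj.
Qed.

Lemma plus_idem a : plus a * plus a = plus a.
Proof. by case: (plusP a (LAC_left_ample S)). Qed.

Lemma plus_Rstar a : Rstar a (plus a).
Proof. by case: (plusP a (LAC_left_ample S)). Qed.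

Lemma mul_plus a : plus a * a = a.
Proof. exact: Rstar_fix (Rstar_sym (plus_Rstar a)) (plus_idem a). Qed.

Lemma plus_Rstar_eq a b : Rstar a b -> plus b = plus a.
Proof.
move=> ab; have [com _ _] := LAC_left_ample S.
apply: plus_unique com (plus_idem a) _.
exact: Rstar_trans (Rstar_sym ab) (plus_Rstar a).
Qed.

(** The graph is made of multiples by elements of [S], not of [S^1]: the pair
    [(a, b)] itself is reached because [a^+ = b^+] is a left identity for both. *)
Lemma graph_mem a b : Rstar a b -> graph a b (a, b).
Proof.
move=> ab; exists (plus a).
by rewrite mul_plus -(plus_Rstar_eq ab) mul_plus.
Qed.

Lemma graph_fun a b x y z : Rstar a b ->
  graph a b (x, y) -> graph a b (x, z) -> y = z.
Proof.
move=> ab [s [-> ->]] [t [st ->]].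
exact: Rstar_eq ab st.
Qed.

Lemma graph_sym a b x y : graph a b (x, y) <-> graph b a (y, x).
Proof. by split=> -[z [-> ->]]; exists z. Qed.

Lemma mul_mul1l z (u : option (LAC_S S)) a : z * mul1l u a = mul1r z u * a.
Proof. by case: u => //= u; rewrite mulgA. Qed.

(** Moving the generator [a |-> b] of a fraction within its L-class.  If [v]
    brings [u b] back to [b], then it brings [u a] back to [a] by R*, so that
    [(a, b)] and [(u a, u b)] are multiples of each other. *)
Lemma graph_mul1l (u v : option (LAC_S S)) a b : Rstar a b ->
  b = mul1l v (mul1l u b) -> graph (mul1l u a) (mul1l u b) = graph a b.
Proof.
move=> ab vb.
have [w wE] : exists w, forall x, mul1l v (mul1l u x) = mul1l w x.
  case: u v {vb} => [u|] [v|] /=; [exists (Some (v * u)) | exists (Some u)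
    | exists (Some v) | exists None] => x //=; exact: mulgA.
have va : a = mul1l v (mul1l u a).
  by rewrite wE; symmetry; apply: (proj2 (ab w None)); rewrite /= -wE.
apply/seteqP; split=> _ [z ->].
  by exists (mul1r z u); rewrite !mul_mul1l.
by exists (mul1r z v); rewrite -!mul_mul1l -va -vb.
Qed.

Definition graph_comp (A B : set (LAC_S S * LAC_S S)) :=
  [set p | exists t, A (p.1, t) /\ B (t, p.2)] : set (LAC_S S * LAC_S S).

Lemma graph_compA A B C :
  graph_comp A (graph_comp B C) = graph_comp (graph_comp A B) C.
Proof.
apply/seteqP; split=> -[x y].
  by move=> [t [/= xt [w [/= tw wy]]]]; exists w; split=> //; exists t.
by move=> [t [/= [w [/= xw wt] ty]]]; exists w; split=> //; exists t.
Qed.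

(** The composite is defined on the part of [S a] that lands in [Sb ∩ Sc = S m];
    it is generated by the pair of elements lying over [m = u b = v c]. *)
Lemma graph_comp_graph a b c d u v m :
    Rstar a b -> Rstar c d -> lmult b `&` lmult c = lmult m ->
    u * b = m -> v * c = m ->
  graph_comp (graph a b) (graph c d) = graph (u * a) (v * d).
Proof.
move=> ab cd bcm um vm; apply/seteqP; split=> -[x y].
  move=> [t [/= [z [-> ->]] [w [zw ->]]]].
  have [s _ sm] : lmult m (z * b).
    by rewrite -bcm; split; [exists z | exists w].
  exists s; congr pair; rewrite mulgA.
    by apply: Rstar_eq (Rstar_sym ab) _; rewrite -mulgA um sm.
  by apply: Rstar_eq cd _; rewrite -mulgA vm sm.
move=> [z [-> ->]]; exists (z * m); split; [exists (z * u) | exists (z * v)].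
  by rewrite -um !mulgA.
by rewrite -vm !mulgA.
Qed.

Fact is_fraction_comp p q : is_fraction (graph_comp (sval p) (sval q)).
Proof.
have [a [b [ab ->]]] := fracP p; have [c [d [cd ->]]] := fracP q.
have [m bcm] := LAC_LC b c.
have self : lmult m m by exists (plus m) => //; apply: mul_plus.
have [[u _ um] [v _ vm]] : (lmult b `&` lmult c) m by rewrite bcm.
exists (u * a), (v * d); split; last exact: graph_comp_graph bcm um vm.
apply: (Rstar_trans (b := m)).
  by rewrite -um; apply: Rstar_mull.
by rewrite -vm; apply: Rstar_mull.
Qed.

Definition fraction_comp p q : fraction := exist _ _ (is_fraction_comp p q).

Fact fraction_compA : associative fraction_comp.
Proof. by move=> p q r; apply: fraction_inj; rewrite /= graph_compA. Qed.

HB.instance Definition _ := isSemigroup.Build fraction fraction_compA.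

Lemma fraction_fun q x y z : sval q (x, y) -> sval q (x, z) -> y = z.
Proof. by have [a [b [ab ->]]] := fracP q; apply: graph_fun. Qed.

Lemma fraction_functional_inj q x y z : sval q (x, z) -> sval q (y, z) -> x = y.
Proof.
have [a [b [ab ->]]] := fracP q => /graph_sym xz /graph_sym yz.
exact: graph_fun (Rstar_sym ab) xz yz.
Qed.

Lemma frac_mul a b c (ab : Rstar a b) (bc : Rstar b c) :
  frac ab * frac bc = frac (Rstar_trans ab bc).
Proof.
apply: fraction_inj; apply/seteqP; split=> -[x y] /=.
  move=> [t [/= [z [-> ->]] [w [zw ->]]]].
  by exists z; congr pair; exact: Rstar_eq bc (esym zw).
by move=> [z [-> ->]]; exists (z * b); split; exists z.
Qed.

Lemma frac_irr a b (ab ab' : Rstar a b) : frac ab = frac ab'.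
Proof. exact: fraction_inj. Qed.

(** The inverse is the converse relation.  Its uniqueness holds for partial
    injections in general: in [q s q = q] and [s q s = s] the intermediate points
    are forced. *)
Lemma fraction_inverse : inverse_semigroup fraction.
Proof.
move=> q; have [a [b [ab qE]]] := fracP q.
pose r := frac (Rstar_sym ab).
have rE x y : sval r (x, y) <-> sval q (y, x) by rewrite qE; apply: graph_sym.
exists r; split.
  by rewrite qE /r !frac_mul; split; apply: frac_irr.
move=> s [qsq sqs]; apply: fraction_inj; apply/seteqP; split=> -[x y].
  rewrite rE => yx; move: (yx); rewrite -{1}qsq => -[t [/= [w [/= yw wt] tx]]].
  have tE := fraction_functional_inj tx yx.
  have wE := fraction_fun yw yx.
  by rewrite -tE -wE.
rewrite rE => xy; move: (xy); rewrite -{1}sqs => -[t [/= [w [/= xw wt] ty]]].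
have tE := fraction_functional_inj ty xy.
have wE := fraction_fun xw xy.
by rewrite -tE -wE.
Qed.

Lemma frac_greenR a b c (ab : Rstar a b) (ac : Rstar a c) :
  greenR (frac ab) (frac ac).
Proof.
apply/greenRP; exists (Some (frac (Rstar_trans (Rstar_sym ac) ab))).
exists (Some (frac (Rstar_trans (Rstar_sym ab) ac))).
by rewrite /= !frac_mul; split; apply: frac_irr.
Qed.

Lemma frac_greenL a b c (ac : Rstar a c) (bc : Rstar b c) :
  greenL (frac ac) (frac bc).
Proof.
apply/greenLP; exists (Some (frac (Rstar_trans ac (Rstar_sym bc)))).
exists (Some (frac (Rstar_trans bc (Rstar_sym ac)))).
by rewrite /= !frac_mul; split; apply: frac_irr.
Qed.

(** For fractions [a |-> b] and [c |-> d], universality of R*∘L gives [e] with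
    [a R* e] and [e L d].  Rescaling [c |-> d] to end at [e], the fraction
    [a |-> e] has the domain of the first and the image of the second. *)
Lemma fraction_bisimple : bisimple fraction.
Proof.
move=> p q; have [a [b [ab ->]]] := fracP p; have [c [d [cd ->]]] := fracP q.
have [e [ae /greenLP[u [v [ed de]]]]] := LAC_universal a d.
exists (frac ae); split; first exact: frac_greenR.
have uce : Rstar (mul1l u c) e by rewrite ed; apply: Rstar_mul1l.
have -> : frac cd = frac uce; last exact: frac_greenL.
apply: fraction_inj => /=; rewrite ed (graph_mul1l (v := v)) //.
by rewrite -ed.
Qed.

(** Right translation by [a], restricted to [S a^+], where it is injective. *)
Definition rho a : fraction := frac (Rstar_sym (plus_Rstar a)).

Lemma rhoE a x y : sval (rho a) (x, y) <-> x * plus a = x /\ y = x * a.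
Proof.
split=> [[z [-> ->]]|[xa ->]].
  by rewrite -!mulgA plus_idem mul_plus.
by exists x; rewrite xa.
Qed.

Lemma plus_mul_plus a b : plus (a * plus b) = plus (a * b).
Proof. exact: plus_Rstar_eq (Rstar_mull a (plus_Rstar b)). Qed.

Lemma plus_mul_plusl a b : plus (a * b) * plus a = plus (a * b).
Proof.
have [com _ _] := LAC_left_ample S.
have [_ ->] := com _ _ (plus_idem (a * b)) (plus_idem a).
by apply: (Rstar_fix (plus_Rstar (a * b))); rewrite mulgA mul_plus.
Qed.

Lemma mul_plus_swap a b : a * plus b = plus (a * b) * a.
Proof. by have [_ _ ->] := LAC_left_ample S; rewrite plus_mul_plus. Qed.

(** Multiplicativity is an equality of domains: [x a^+ = x] and
    [x a b^+ = x a] must amount to [x (ab)^+ = x].  The left ample identity,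
    [a b^+ = (ab)^+ a], is exactly what translates one into the other. *)
Lemma rhoM : {morph rho : a b / a * b}.
Proof.
move=> a b; apply: fraction_inj; apply/seteqP; split=> -[x y].
  move=> /rhoE[xab ->]; exists (x * a); rewrite !rhoE /=; split; split=> //.
  - by rewrite -xab -mulgA plus_mul_plusl.
  - by rewrite -mulgA mul_plus_swap mulgA xab.
  - exact: mulgA.
move=> [t [/= /rhoE[xa tE] /rhoE[tb ->]]]; apply/rhoE; rewrite tE -mulgA.
split=> //; rewrite -plus_mul_plusl mulgA -[RHS]xa.
apply: (Rstar_eq (plus_Rstar a)).
by rewrite -mulgA -mul_plus_swap mulgA -tE.
Qed.

Lemma rho_mem a : sval (rho a) (plus a, a).
Proof. exact: graph_mem (Rstar_sym (plus_Rstar a)). Qed.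

Lemma rho_inj : injective rho.
Proof.
move=> a b ab; have [com _ _] := LAC_left_ample S.
have /rhoE[pab aE] : sval (rho b) (plus a, a) by rewrite -ab; apply: rho_mem.
have /rhoE[pba _] : sval (rho a) (plus b, b) by rewrite ab; apply: rho_mem.
have [_ pC] := com _ _ (plus_idem a) (plus_idem b).
by rewrite aE -pab pC pba mul_plus.
Qed.

Definition rho_image : set fraction := range rho.

Fact rho_subsemigroup : subsemigroup rho_image.
Proof.
split; first by have [a] := LAC_nonempty S; exists (rho a), a.
by move=> _ _ [a _ <-] [b _ <-]; exists (a * b) => //; rewrite rhoM.
Qed.

(** Right multiplication cannot enlarge the domain, so R-related fractions have
    the same one. *)
Lemma fraction_dom p q (u : option fraction) x y :
  p = mul1r q u -> sval p (x, y) -> exists t, sval q (x, t).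
Proof.
case: u => [u|] -> /=; last by exists y.
by move=> [t [/= qt _]]; exists t.
Qed.

(** If [q] is R-related to [rho a], its domain is [S a^+], which contains [a^+].
    A map of left acts with this domain is right translation by its value [y] at
    [a^+], and [y^+ = a^+]; so [q = rho y]. *)
Fact rho_union : union_of_Rclasses rho_image.
Proof.
exists rho_image; apply/seteqP; split=> [q Aq|q [_ [a _ <-] /= /greenRP]].
  by exists q.
move=> [u [v [au qv]]].
have [c [d [cd qE]]] := fracP q.
have [z paE] : exists z, plus a = z * c.
  have [y] := fraction_dom au (rho_mem a).
  by rewrite qE => -[z [-> _]]; exists z.
have ca : c * plus a = c.
  have qcd : sval q (c, d) by rewrite qE; apply: graph_mem.
  by have [t /rhoE[]] := fraction_dom qv qcd.
have pza : plus (z * d) = plus a.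
  have [com _ _] := LAC_left_ample S.
  apply: plus_unique com (plus_idem a) _.
  by rewrite paE; apply: Rstar_mull; apply: Rstar_sym.
have czd : c * z * d = d.
  by apply: (Rstar_fix cd); rewrite -mulgA -paE.
exists (z * d) => //; apply: fraction_inj; rewrite qE.
apply/seteqP; split=> -[x y].
  move=> /rhoE[]; rewrite pza => xa ->; exists (x * z).
  by rewrite -!mulgA -paE xa.
move=> [s [-> ->]]; apply/rhoE; rewrite pza -!mulgA ca.
by rewrite (mulgA c) czd.
Qed.

Definition fraction_BIS : BIS_obj :=
  BISObj fraction_inverse fraction_bisimple rho_subsemigroup rho_union.

End Fractions.

Lemma carrier_functor_essentially_surjective (S : LAC_obj) :
  exists (X : BIS_obj) (h : LAC_hom (carrier_LAC X) S), is_iso (C := LAC) h.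
Proof.
exists (fraction_BIS S).
have rS a : BIS_S (fraction_BIS S) (rho a) by exists a.
pose g a : carrier (fraction_BIS S) := carrier_of (rS a).
have gM : {morph g : a b / a * b} by move=> a b; apply: val_inj; apply: rhoM.
have ginj : injective g by move=> a b /(congr1 val)/rho_inj.
have gsurj q : exists a, g a = q.
  by have [a _ aq] := carrierP q; exists a; apply: val_inj.
exact: (@LAC_iso_of_bijective S (carrier_LAC (fraction_BIS S)) g gM ginj gsurj).
Qed.

Theorem theorem5p4 : equivalent_categories BIS LAC.
Proof.
apply: (equivalence_of_fully_faithful (F := carrier_functor)).
- exact: carrier_functor_faithful.
- exact: carrier_functor_full.
- exact: carrier_functor_essentially_surjective.
Qed.
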